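(* Let $b$ be a locally finite graph over a countable set $X$. The following statements are equivalent: (i) $R=\delta_w$ for some weight $w$ compatible to $b$; (ii) $b$ is a block graph.
   Context: A graph over a countable set $X$ is a symmetric map $b:X\times X\to[0,\infty)$ with $b(x,x)=0$ and $\sum_{y}b(x,y)<\infty$ for all $x$; $x\sim y$ means $b(x,y)>0$. It is locally finite if every vertex has finitely many neighbours. A block graph is a graph in which any two vertices are connected by a unique induced path. For $f:X\to\mathbb R$ let $Q(f):=\frac12\sum_{x,y}b(x,y)(f(x)-f(y))^2$; the resistance metric is $R(x,y):=\sup\{(f(y)-f(x))^2\mid Q(f)=1\}$. A weight on $X$ is a symmetric $w:X\times X\to[0,\infty]$ with $w(x,y)=0$ iff $x=y$; it is compatible to $b$ if $w(x,y)=\infty$ whenever $b(x,y)=0$ and $x\ne y$. $\delta_w(x,y):=\inf\{\sum_{i=1}^n w(x_{i-1},x_i)\mid (x_0,\dots,x_n)\text{ distinct elements of }X,\ x_0=x,\ x_n=y\}$.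
   Formalization: The graph b is additionally assumed connected; without this the claim fails, e.g. for two disjoint edges, where R = δ_w with w = 1/b on edges and ∞ across components, but b is not a block graph. *)

(* Defs.v *)
From HB Require Import structures.
From mathcomp Require Import all_boot all_order all_algebra.
From mathcomp Require Import all_classical all_reals all_analysis.
Set Implicit Arguments. Unset Strict Implicit. Unset Printing Implicit Defensive.
Import Order.TTheory GRing.Theory Num.Theory.
Local Open Scope classical_set_scope.
Local Open Scope ring_scope.

Section Defs.
Context {R : realType} {X : countType}.

Definition is_graph (b : X -> X -> R) : Prop :=
  (forall x y, 0 <= b x y) /\
  (forall x y, b x y = b y x) /\
  (forall x, b x x = 0) /\
  (forall x, (\esum_(y in [set: X]) (b x y)%:E < +oo)%E).

Definition locally_finite (b : X -> X -> R) : Prop :=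
  forall x, finite_set [set y | 0 < b x y].

Definition connected_graph (b : X -> X -> R) : Prop :=
  forall x y, exists s : seq X,
    path.path (fun u v => 0 < b u v) x s /\ last x s = y.

Definition energy (b : X -> X -> R) (f : X -> R) : \bar R :=
  ((2^-1)%:E * \esum_(p in [set: X * X])
      (b p.1 p.2 * (f p.1 - f p.2) ^+ 2)%:E)%E.

(* resistance metric R(x,y) = sup{(f y - f x)^2 | Q(f) = 1}, as a sup in
   [0,+oo] (so the supremum of the empty family is 0) *)
Definition resistance (b : X -> X -> R) (x y : X) : \bar R :=
  ereal_sup ([set 0%E] `|`
    [set ((f y - f x) ^+ 2)%:E | f in [set f : X -> R | energy b f = 1%E]]).

Definition is_weight (w : X -> X -> \bar R) : Prop :=
  (forall x y, (0 <= w x y)%E) /\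
  (forall x y, w x y = w y x) /\
  (forall x y, w x y = 0%E <-> x = y).

Definition compatible (b : X -> X -> R) (w : X -> X -> \bar R) : Prop :=
  forall x y, x <> y -> b x y = 0 -> w x y = +oo%E.

Definition delta (w : X -> X -> \bar R) (x y : X) : \bar R :=
  ereal_inf [set (\sum_(p <- zip (x :: s) s) w p.1 p.2)%E
            | s in [set s : seq X | uniq (x :: s) /\ last x s = y]].

Definition induced_path (b : X -> X -> R) (x y : X) (s : seq X) : Prop :=
  uniq (x :: s) /\ last x s = y /\
  forall i j, (i < size (x :: s))%N -> (j < size (x :: s))%N ->
    (0 < b (nth x (x :: s) i) (nth x (x :: s) j) <-> (i = j.+1 \/ j = i.+1)).

Definition block_graph (b : X -> X -> R) : Prop :=
  forall x y, exists! s : seq X, induced_path b x y s.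

End Defs.

(* Main.v *)
(* Everything rests on how R behaves under triangles x, z, y.

   If z separates x from y, then gluing test functions for (x,z) and (z,y) at z
   shows R(x,y) >= R(x,z) + R(z,y). In a block graph the second vertex of an
   induced path separates its end points, hence R is the sum of the edge
   resistances along the induced path; by the triangle inequality no other path
   is cheaper.

   Conversely, cutting a test function f for (x,y) at the level f z gives
   R(x,y) <= R(x,z) + R(z,y), and if some path from x to y avoids z the
   inequality is strict: the part below the level is constant at the level on
   both y and z, and the maximum principle along the path bounds its energy away
   from the minimum for (x,z). As x has finitely many neighbours, R = delta_w
   provides, for non-adjacent x and y, a neighbour z of x with equality, so z
   separates x from y and is the second vertex of every induced path from x
   to y. *)
Require Import Defs.
From HB Require Import structures.
From mathcomp Require Import all_boot all_order all_algebra.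
From mathcomp Require Import all_classical all_reals all_analysis.
From mathcomp Require Import zify ring lra.
Set Implicit Arguments. Unset Strict Implicit. Unset Printing Implicit Defensive.
Import Order.TTheory GRing.Theory Num.Theory.
Local Open Scope classical_set_scope.
Local Open Scope ring_scope.

(** * Energy *)

Section PairSums.
Context {R : realType} {X : countType}.
Implicit Types F G : X * X -> R.

Definition pair_sum F : \bar R :=
  ((2^-1)%:E * \esum_(p in [set: X * X]) (F p)%:E)%E.

Lemma pair_sum_ge0 F : (forall p, 0 <= F p) -> (0 <= pair_sum F)%E.
Proof.
by move=> F0; rewrite mule_ge0 ?lee_fin ?invr_ge0 ?esum_ge0 => //= p _; rewrite lee_fin.
Qed.

Lemma le_pair_sum F G : (forall p, F p <= G p) -> (pair_sum F <= pair_sum G)%E.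
Proof.
move=> FG; rewrite lee_wpmul2l ?lee_fin ?invr_ge0//.
by apply: le_esum => p _; rewrite lee_fin.
Qed.

Lemma pair_sumD F G : (forall p, 0 <= F p) -> (forall p, 0 <= G p) ->
  pair_sum (fun p => F p + G p) = (pair_sum F + pair_sum G)%E.
Proof.
move=> F0 G0; rewrite /pair_sum -ge0_muleDr ?esum_ge0// => [|p _|p _]; rewrite ?lee_fin//.
by rewrite -esumD => // [p _|p _]; rewrite lee_fin.
Qed.

Lemma pair_sum_scale_le F (c : R) : 0 <= c -> (forall p, 0 <= F p) ->
  (pair_sum (fun p => (c * F p)%R) <= c%:E * pair_sum F)%E.
Proof.
move=> c0 F0; rewrite /pair_sum muleCA lee_wpmul2l ?lee_fin ?invr_ge0//.
apply: ge_ereal_sup => _ [A [finA _] <-].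
under eq_fsbigr do rewrite EFinM.
rewrite -ge0_mule_fsumr; last by move=> p; rewrite lee_fin.
rewrite lee_wpmul2l ?lee_fin// esum_ge//; exists A => //; split => //.
Qed.

(** An edge occurs in both orientations, which cancels the factor one half; [x != y] keeps the two
    pairs distinct. *)
Lemma pair_sum_ge F x y (c : R) : x != y -> (forall p, 0 <= F p) ->
  c <= F (x, y) -> c <= F (y, x) -> (c%:E <= pair_sum F)%E.
Proof.
move=> xy F0 c1 c2.
have S : ((F (x, y) + F (y, x))%:E <= \esum_(p in [set: X * X]) (F p)%:E)%E.
  apply: esum_ge; exists [set (x, y); (y, x)]; first by split => //; exact: finite_set2.
  rewrite fsbigU0 ?fsbig_set1 ?EFinD//.
  move=> p /= [->] [e _]; by rewrite e eqxx in xy.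
apply: (@le_trans _ _ ((2^-1)%:E * (F (x, y) + F (y, x))%:E)%E).
  by rewrite lee_fin; lra.
by rewrite lee_wpmul2l ?lee_fin ?invr_ge0.
Qed.


Lemma pair_sum_scale F (c : R) : 0 < c -> (forall p, 0 <= F p) ->
  pair_sum (fun p => c * F p) = (c%:E * pair_sum F)%E.
Proof.
move=> c0 F0; apply/eqP; rewrite eq_le (pair_sum_scale_le (ltW c0))//=.
have cF0 p : 0 <= c * F p by rewrite mulr_ge0// ltW.
have ci0 : 0 <= c^-1 by rewrite invr_ge0 ltW.
have := pair_sum_scale_le ci0 cF0.
have -> : (fun p => c^-1 * (c * F p)) = F by apply/funext => p; rewrite mulKf ?gt_eqF.
by rewrite lee_pdivlMl.
Qed.

End PairSums.

(** * Energy estimates: scaling, gluing, cutting, lowering at one vertex *)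

Section Energy.
Context {R : realType} {X : countType} (b : X -> X -> R).
Hypothesis gb : is_graph b.
Implicit Types f g h : X -> R.

Let b_ge0 x y : 0 <= b x y. Proof. by case: gb. Qed.
Let bC x y : b x y = b y x. Proof. by case: gb => _ []. Qed.
Let bxx x : b x x = 0. Proof. by case: gb => _ [] _ []. Qed.

Let energyE f :
  energy b f = pair_sum (fun p => b p.1 p.2 * (f p.1 - f p.2) ^+ 2).
Proof. by []. Qed.

Let term_ge0 f (p : X * X) : 0 <= b p.1 p.2 * (f p.1 - f p.2) ^+ 2.
Proof. by rewrite mulr_ge0// sqr_ge0. Qed.

Lemma energy_ge0 f : (0 <= energy b f)%E.
Proof. exact: pair_sum_ge0. Qed.

Lemma eq_energy f g :
  (forall u v, (f u - f v) ^+ 2 = (g u - g v) ^+ 2) -> energy b f = energy b g.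
Proof.
by move=> fg; rewrite !energyE; congr pair_sum; apply/funext => p; rewrite fg.
Qed.

Lemma energyZ f (c : R) : c != 0 ->
  energy b (fun u => c * f u) = ((c ^+ 2)%:E * energy b f)%E.
Proof.
move=> c0; rewrite !energyE -pair_sum_scale => [|//|//].
  by congr pair_sum; apply/funext => p; rewrite -mulrBr exprMn mulrCA.
by rewrite exprn_even_gt0.
Qed.

Lemma energy_const (c : R) : energy b (fun=> c) = 0%E.
Proof.
by rewrite /energy esum1 ?mule0// => p _; rewrite subrr expr0n mulr0.
Qed.

(** The form of scaling that also covers [c = 0], as gluing uses coefficients that may vanish. *)
Lemma energyZ_le f (c e : R) : (energy b f <= e%:E)%E ->
  (energy b (fun u => (c * f u)%R) <= (c ^+ 2 * e)%:E)%E.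
Proof.
move=> fe; rewrite EFinM.
apply: (@le_trans _ _ ((c ^+ 2)%:E * energy b f)%E); last first.
  by rewrite lee_wpmul2l// lee_fin sqr_ge0.
rewrite !energyE; apply: le_trans (pair_sum_scale_le (sqr_ge0 c) (term_ge0 f)).
by apply: le_pair_sum => p; rewrite -mulrBr exprMn mulrCA.
Qed.

Lemma energy_edge f u v (e : R) :
  (energy b f <= e%:E)%E -> b u v * (f u - f v) ^+ 2 <= e.
Proof.
move=> fe; have [<-|uv] := eqVneq u v.
  by rewrite bxx mul0r -lee_fin; apply: le_trans fe; exact: energy_ge0.
rewrite -lee_fin; apply: le_trans fe; apply: (pair_sum_ge uv) => //=.
by rewrite (bC v) -(opprB (f u)) sqrrN.
Qed.

Lemma energy_glue f g h (e1 e2 : R) :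
  (forall u v, b u v * (h u - h v) ^+ 2 <=
     b u v * (f u - f v) ^+ 2 + b u v * (g u - g v) ^+ 2) ->
  (energy b f <= e1%:E)%E -> (energy b g <= e2%:E)%E ->
  (energy b h <= (e1 + e2)%:E)%E.
Proof.
move=> hfg fe ge; rewrite EFinD; apply: le_trans (leeD fe ge).
by rewrite !energyE -pair_sumD//; apply: le_pair_sum => p; exact: hfg.
Qed.

(* The cross terms of f = min f t + max f t - t are nonnegative. *)
Lemma energy_minmax f (t e : R) : (energy b f <= e%:E)%E ->
  exists e1 e2 : R, [/\ e1 + e2 <= e,
    (energy b (fun u => Num.min (f u) t) <= e1%:E)%E &
    (energy b (fun u => Num.max (f u) t) <= e2%:E)%E].
Proof.
move=> fe.
have S : (energy b (fun u => Num.min (f u) t) +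
          energy b (fun u => Num.max (f u) t) <= e%:E)%E.
  apply: le_trans fe; rewrite !energyE.
  rewrite -pair_sumD => [|p|p]; try by rewrite mulr_ge0 ?sqr_ge0.
  apply: le_pair_sum => -[u v] /=.
  rewrite -mulrDr ler_wpM2l//.
  by case: (leP (f u) t) => ?; case: (leP (f v) t) => ?; nra.
have m0 := energy_ge0 (fun u => Num.min (f u) t).
have M0 := energy_ge0 (fun u => Num.max (f u) t).
move: S m0 M0.
case: (energy b _) => [e1| |]; case: (energy b _) => [e2| |]//.
by move=> S _ _; exists e1, e2; split => //; rewrite -lee_fin.
Qed.

(** Since [f u - f z >= - eta], lowering [f] by [s] at [u] costs at most [2 * s * eta + s ^+ 2] per
    unit of edge weight at [u], a weight bounded by [d] in total. On the edge to [v], where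
    [f u - f v >= eps - eta], it saves [2 * s * eps] per unit. *)
Lemma energy_lower f u v (e d s eps eta : R) :
  u != v -> 0 <= s -> 0 <= eps -> 0 <= eta ->
  (forall z, f z <= 1) -> 1 - eta <= f u -> f v <= 1 - eps ->
  (energy b f <= e%:E)%E ->
  (energy b (fun z => (z == u)%:R) <= d%:E)%E ->
  (energy b (fun z => (f z - s * (z == u)%:R)%R) <=
     (e + (2 * s * eta + s ^+ 2) * d - 2 * s * eps * b u v)%:E)%E.
Proof.
move=> uv s0 eps0 eta0 f1 fu fv fe ud.
set k := 2 * s * eta + s ^+ 2.
have k0 : 0 <= k by rewrite addr_ge0 ?sqr_ge0// !mulr_ge0.
set m := 2 * s * eps * b u v.
have m0 : 0 <= m by rewrite !mulr_ge0.
(* The saving is moved to the left as a summand carried by both orientations of the edge, so that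
   the claim can be checked pair by pair. *)
pose G (p : X * X) := if (p == (u, v)) || (p == (v, u)) then m else 0.
have G0 p : 0 <= G p by rewrite /G; case: ifP.
rewrite EFinB leeBrDr//.
have Gm : (m%:E <= pair_sum G)%E.
  by apply: (pair_sum_ge uv) => //; rewrite /G eqxx ?orbT.
apply: (le_trans (leeD2l _ Gm)).
rewrite EFinD EFinM.
have kd : (k%:E * energy b (fun z => (z == u)%:R) <= k%:E * d%:E)%E.
  by rewrite lee_wpmul2l ?lee_fin.
apply: le_trans (leeD fe kd).
have uk := pair_sum_scale_le k0 (term_ge0 (fun z => (z == u)%:R)).
apply: le_trans (leeD2l (energy b f) uk).
rewrite !energyE -!pair_sumD => *;
  try by repeat (apply: sqr_ge0 || apply: mulr_ge0 || done).
apply: le_pair_sum => -[x y] /=.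
have key z : b u z * (f u - s - f z) ^+ 2 + (if z == v then m else 0) <=
   b u z * (f u - f z) ^+ 2 + k * b u z.
  have bz := b_ge0 u z; have fz := f1 z.
  have [->|zv] := eqVneq z v.
    suff : 0 <= b u v * (2 * s * (f u - f v + eta - eps)) by rewrite /m /k; lra.
    by rewrite mulr_ge0// mulr_ge0 ?mulr_ge0//; lra.
  suff : 0 <= b u z * (2 * s * (f u - f z + eta)) by rewrite /k; lra.
  by rewrite mulr_ge0// mulr_ge0 ?mulr_ge0//; lra.
rewrite /G !xpair_eqE.
have [->|xu] := eqVneq x u; have [->|yu] := eqVneq y u.
- by rewrite bxx !mul0r mulr0 !add0r (negbTE uv) andbF.
- have := key y; rewrite (eq_sym y v) /=.
  rewrite (negbTE uv) /= orbF subr0 mulr1 mulr0 subr0 expr1n mulr1.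
  by rewrite (eq_sym v y).
- have := key x; rewrite (bC x) orFb andbT /= sub0r sqrrN expr1n !mulr1 mulr0 subr0.
  by rewrite -(opprB (f x)) -(opprB (f u)) !sqrrN opprB /=; lra.
- by rewrite andbF /= !mulr0 !subr0 expr0n/= !mulr0 !addr0.
Qed.

Lemma energy_indicator (lf : locally_finite b) u :
  exists d : R, (energy b (fun z => (z == u)%:R) <= d%:E)%E.
Proof.
pose N := [set v | 0 < b u v].
pose S := ([set u] `*` N) `|` (N `*` [set u]).
have finS : finite_set S.
  by rewrite finite_setU; split; apply: finite_setX; (exact: finite_set1 || exact: lf).
rewrite /energy (esumID S); last first.
  by move=> p _; rewrite lee_fin; exact: term_ge0 (fun z => (z == u)%:R) p.
rewrite [X in (_ + X)%E]esum1 ?adde0; last first.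
  move=> [v w] [_ Svw] /=; congr EFin.
  have [vu|vu] := eqVneq v u; have [wu|wu] := eqVneq w u.
  - by rewrite vu wu bxx mul0r.
  - have /negP : ~ (0 < b v w) by move=> bvw; apply: Svw; left; split => //=; rewrite /N /= -vu.
    by rewrite lt_neqAle b_ge0 andbT negbK => /eqP <-; rewrite mul0r.
  - have /negP : ~ (0 < b v w).
      by move=> bvw; apply: Svw; right; split => //=; rewrite /N /= bC -wu.
    by rewrite lt_neqAle b_ge0 andbT negbK => /eqP <-; rewrite mul0r.
  - by rewrite subrr expr0n mulr0.
rewrite setTI esum_fset//; last first.
  by move=> p _; rewrite lee_fin; exact: term_ge0 (fun z => (z == u)%:R) p.
rewrite fsumEFin//= -EFinM.
by eexists; exact: lexx.
Qed.

End Energy.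

(** * Resistance *)

Section Resistance.
Context {R : realType} {X : countType} (b : X -> X -> R).
Hypotheses (gb : is_graph b) (lf : locally_finite b) (cb : connected_graph b).
Implicit Types f g h : X -> R.

Let b_ge0 x y : 0 <= b x y. Proof. by case: gb. Qed.
Let bC x y : b x y = b y x. Proof. by case: gb => _ []. Qed.
Let bxx x : b x x = 0. Proof. by case: gb => _ [] _ []. Qed.

Lemma resistance_ge0 x y : (0 <= resistance b x y)%E.
Proof. by apply: ereal_sup_ubound; left. Qed.

Lemma resistancexx x : resistance b x x = 0%E.
Proof.
apply/eqP; rewrite eq_le resistance_ge0 andbT.
apply: ge_ereal_sup => _ [->//|[f _ <-]]; by rewrite subrr expr0n.
Qed.

Lemma resistance_le x y (r : R) : 0 <= r ->
  (forall f, (energy b f <= 1%:E)%E -> (f y - f x) ^+ 2 <= r) ->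
  (resistance b x y <= r%:E)%E.
Proof.
move=> r0 fr; apply: ge_ereal_sup => _ [->//|[f /= f1 <-]].
by rewrite lee_fin; apply: fr; rewrite f1.
Qed.

Lemma energy0_const f x y : (energy b f <= 0%:E)%E -> f x = f y.
Proof.
move=> f0; have [s [+ <-]] := cb x y.
elim: s x => [//|u s IH] x /= /andP[xu us].
rewrite -(IH u us); apply/eqP; rewrite -subr_eq0 -sqrf_eq0.
have := energy_edge gb x u f0; rewrite pmulr_rle0// => le0.
by rewrite eq_le le0 sqr_ge0.
Qed.

(** By homogeneity: divide [f] by the square root of its energy. If the energy vanishes, [f] is
    constant by connectedness. *)
Lemma sqr_le_resistance f x y (r e : R) :
  (resistance b x y <= r%:E)%E -> (energy b f <= e%:E)%E ->
  (f y - f x) ^+ 2 <= r * e.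
Proof.
move=> xyr fe.
have r0 : 0 <= r by rewrite -lee_fin; apply: le_trans xyr; exact: resistance_ge0.
have e0 : 0 <= e by rewrite -lee_fin; apply: le_trans fe; exact: energy_ge0.
move: (energy_ge0 gb f) fe; case Ef : (energy b f) => [q| |]//.
rewrite !lee_fin => q0 qe.
have [q00|qN0] := eqVneq q 0.
  by rewrite (@energy0_const f x y) ?Ef ?q00// subrr expr0n mulr_ge0.
have qp : 0 < q by rewrite lt_neqAle eq_sym qN0.
have sq : Num.sqrt q != 0 by rewrite sqrtr_eq0 -ltNge.
pose g u := (Num.sqrt q)^-1 * f u.
have g1 : energy b g = 1%E.
  by rewrite energyZ ?invr_eq0// Ef exprVn sqr_sqrtr// -EFinM mulVf.
have : (((g y - g x) ^+ 2)%:E <= r%:E)%E.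
  by apply: le_trans xyr; apply: ereal_sup_ubound; right; exists g.
rewrite lee_fin /g -mulrBr exprMn exprVn sqr_sqrtr// ler_pdivrMl// mulrC => le1.
by apply: (le_trans le1); rewrite ler_wpM2l.
Qed.

(** The indicator of [x] has finite energy and separates [x] from [y]. *)
Lemma resistance_gt0 x y (r : R) :
  x != y -> (resistance b x y <= r%:E)%E -> 0 < r.
Proof.
move=> xy xyr.
have r0 : 0 <= r by rewrite -lee_fin; apply: le_trans xyr; exact: resistance_ge0.
have [d xd] := energy_indicator gb lf x.
have := sqr_le_resistance xyr xd.
rewrite eqxx eq_sym (negbTE xy) sub0r sqrrN expr1n => le1.
rewrite lt_neqAle r0 andbT; apply/eqP => r00; move: le1.
by rewrite -r00 mul0r ler10.
Qed.

Lemma resistance_edge x y : 0 < b x y ->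
  (resistance b x y <= ((b x y)^-1)%:E)%E.
Proof.
move=> xy; apply: resistance_le => [|f f1]; first by rewrite invr_ge0.
rewrite -[X in _ <= X]mulr1 ler_pdivlMl// -(opprB (f x)) sqrrN.
exact: energy_edge.
Qed.

Lemma resistanceC x y : resistance b x y = resistance b y x.
Proof.
congr ereal_sup; congr setU; apply/seteqP; split => _ [f f1 <-]; exists f => //;
  by rewrite -(opprB (f x)) sqrrN.
Qed.

(* Cutting [f] at the level [f z] produces two functions whose energies add up
   to at most that of [f], each carrying one part of the drop from [x] to [y]. *)
Lemma resistance_cut_level x y z (r1 r2 rho : R) :
  (resistance b x z <= r1%:E)%E -> (resistance b z y <= r2%:E)%E -> 0 <= rho ->
  (forall g (e : R), (forall u, g u <= g z) -> g y = g z ->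
     (energy b g <= e%:E)%E -> (g z - g x) ^+ 2 <= rho * e) ->
  (resistance b x y <= (Num.max (rho + r2) (Num.max r1 r2))%:E)%E.
Proof.
move=> xz zy rho0 Hrho.
have r1_ge0 : 0 <= r1 by rewrite -lee_fin; apply: le_trans xz; exact: resistance_ge0.
have r2_ge0 : 0 <= r2 by rewrite -lee_fin; apply: le_trans zy; exact: resistance_ge0.
apply: resistance_le => [|f]; first by rewrite !le_max r1_ge0 orbT.
wlog fxy : f / f x <= f y => [H f1|f1].
  have [fxy|yfx] := leP (f x) (f y); first exact: H.
  have := H (fun u => - f u); rewrite lerN2 -opprD sqrrN => -> //; first exact: ltW.
  by rewrite (@eq_energy _ _ _ _ f)// => u v; rewrite -opprD sqrrN.
have b1 := sqr_le_resistance xz f1; have b2 := sqr_le_resistance zy f1.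
rewrite mulr1 in b1; rewrite mulr1 in b2.
(* If [f z] is not strictly between [f x] and [f y], a single drop to or from [z] already dominates
   the drop from [x] to [y]. *)
have [zx|xz'] := leP (f z) (f x).
  by rewrite !le_max; apply/orP; right; apply/orP; right; nra.
have [yz|zy'] := leP (f y) (f z).
  by rewrite !le_max; apply/orP; right; apply/orP; left; nra.
rewrite le_max; apply/orP; left.
(* The lower truncation attains its maximum at [z] and agrees there with its value at [y], as [Hrho]
   requires. *)
have [e1 [e2 [e12 lo hi]]] := energy_minmax gb (f z) f1.
have c1 := Hrho _ _ _ _ lo; have c2 := sqr_le_resistance zy hi.
rewrite /= !minxx !(min_idPl (ltW xz')) !(min_idPr (ltW zy')) in c1.
rewrite /= !maxxx (max_idPl (ltW zy')) in c2.
have {}c1 : (f z - f x) ^+ 2 <= rho * e1.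
  by apply: c1 => // u; rewrite ge_min lexx orbT.
have e1_ge0 : 0 <= e1 by rewrite -lee_fin; apply: le_trans lo; exact: energy_ge0.
have e2_ge0 : 0 <= e2 by rewrite -lee_fin; apply: le_trans hi; exact: energy_ge0.
set p := f z - f x in c1; set s := f y - f z in c2.
have -> : f y - f x = p + s by rewrite /p /s; lra.
have p0 : 0 <= p by rewrite /p; lra.
have s0 : 0 <= s by rewrite /s; lra.
(* The arithmetic-geometric mean inequality for the cross term; with [c1] and [c2] it yields
   [(p + s) ^+ 2 <= (rho + r2) * (e1 + e2)]. *)
have ps : 2 * (p * s) <= rho * e2 + r2 * e1.
  rewrite -ler_sqr ?nnegrE; [|by rewrite !mulr_ge0|by rewrite addr_ge0 ?mulr_ge0].
  have : p ^+ 2 * s ^+ 2 <= (rho * e1) * (r2 * e2).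
    by rewrite ler_pM ?sqr_ge0.
  by have := sqr_ge0 (rho * e2 - r2 * e1); nra.
have : (rho + r2) * (e1 + e2) <= rho + r2.
  by rewrite -[X in _ <= X]mulr1 ler_wpM2l ?addr_ge0.
nra.
Qed.

Lemma resistance_triangle_le x y z (r1 r2 : R) :
  (resistance b x z <= r1%:E)%E -> (resistance b z y <= r2%:E)%E ->
  (resistance b x y <= (r1 + r2)%:E)%E.
Proof.
move=> xz zy.
have r1_ge0 : 0 <= r1 by rewrite -lee_fin; apply: le_trans xz; exact: resistance_ge0.
have r2_ge0 : 0 <= r2 by rewrite -lee_fin; apply: le_trans zy; exact: resistance_ge0.
apply: (le_trans (@resistance_cut_level x y z r1 r2 r1 xz zy r1_ge0 _)).
  by move=> g e _ _; exact: sqr_le_resistance.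
by rewrite lee_fin !ge_max; apply/and3P; split; lra.
Qed.

Lemma resistance_fin x y : exists r : R, resistance b x y = r%:E.
Proof.
suff [r xyr] : exists r : R, (resistance b x y <= r%:E)%E.
  have := resistance_ge0 x y; move: xyr.
  by case: (resistance b x y) => // r' _ _; exists r'.
have [s [+ <-]] := cb x y.
elim: s x => [|u s IH] x /=; first by exists 0; rewrite resistancexx.
move=> /andP[xu us]; have [r ur] := IH u us.
by eexists; apply: resistance_triangle_le ur; exact: resistance_edge.
Qed.

Lemma resistance_triangle x y z :
  (resistance b x y <= resistance b x z + resistance b z y)%E.
Proof.
have [r1 E1] := resistance_fin x z; have [r2 E2] := resistance_fin z y.
by rewrite E1 E2 -EFinD; apply: (@resistance_triangle_le x y z); rewrite ?E1 ?E2.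
Qed.


Definition adj : rel X := fun u v => 0 < b u v.

Lemma adj_neq u v : adj u v -> u != v.
Proof. by apply: contraTneq => ->; rewrite /adj bxx ltxx. Qed.

(* A path from [y] to [x] avoiding [z] propagates the constraint [g y = 1]
   to [x]: for near-minimisers of the resistance problem from [x] to [z], each
   value on the path is close to the maximum 1, since otherwise lowering [g] at
   the previous vertex would save energy. *)
Section StrictTriangle.
Variables (x y z : X) (r : R).
Hypotheses (xz : x != z) (xzr : (resistance b x z <= r%:E)%E).

(** Here [r^-1] bounds from below the energy of any [g] with [g x = 0] and [g z = 1]. One [delta]
    serving all near-minimisers replaces the existence of a minimiser. *)
Definition saturated u := forall eps : R, 0 < eps -> exists2 delta : R, 0 < delta &
  forall g, (forall v, g v <= 1) -> g x = 0 -> g z = 1 -> g y = 1 ->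
    (energy b g <= (r^-1 + delta)%:E)%E -> 1 - eps <= g u.

Lemma saturated_adj u v :
  u != x -> u != z -> adj u v -> saturated u -> saturated v.
Proof.
move=> ux uz uv satu eps eps0.
have r0 := resistance_gt0 xz xzr.
have [d ud] := energy_indicator gb lf u.
set beta := b u v; have beta0 : 0 < beta by [].
have betad : beta <= d.
  have := energy_edge gb u v ud.
  by rewrite eqxx (eq_sym v) (negbTE (adj_neq uv)) subr0 expr1n mulr1.
have d0 : 0 < d by exact: lt_le_trans betad.
(* With these choices lowering at [u] costs [s * (eps * beta)] and saves twice that. The net gain
   exceeds the slack [s * (eps * beta) / 4] allowed below, so the energy would drop under [r^-1]. *)
pose s := eps * beta / (2 * d); pose eta := eps * beta / (4 * d).
have s0 : 0 < s by rewrite divr_gt0 ?mulr_gt0.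
have eta0 : 0 < eta by rewrite divr_gt0 ?mulr_gt0.
have sd : s * d = eps * beta / 2 by rewrite /s; field; rewrite gt_eqF.
have etad : eta * d = eps * beta / 4 by rewrite /eta; field; rewrite gt_eqF.
have seb0 : 0 < s * (eps * beta) by rewrite mulr_gt0// mulr_gt0.
have [delta0 delta00 Hu] := satu eta eta0.
exists (Num.min delta0 (s * (eps * beta) / 4)).
  by rewrite lt_min delta00 divr_gt0.
move=> g g1 gx gz gy gE; rewrite leNgt; apply/negP => /ltW gv.
have gu : 1 - eta <= g u.
  apply: Hu => //; apply: (le_trans gE).
  by rewrite lee_fin lerD2l ge_min lexx.
have := energy_lower gb (adj_neq uv) (ltW s0) (ltW eps0) (ltW eta0) g1 gu gv gE ud.
move=> /(sqr_le_resistance xzr).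
rewrite gx gz eq_sym (negbTE uz) (eq_sym x) (negbTE ux) !mulr0 !subr0 expr1n.
set m := Num.min _ _.
have mle : m <= s * (eps * beta) / 4 by rewrite /m ge_min lexx orbT.
have -> : (2 * s * eta + s ^+ 2) * d = s * (eps * beta).
  have -> : (2 * s * eta + s ^+ 2) * d = 2 * s * (eta * d) + s * (s * d) by ring.
  by rewrite etad sd; field.
rewrite -[X in X <= _](divff (lt0r_neq0 r0)) ler_pM2l// -/beta.
set A := s * (eps * beta) in mle seb0 *.
have -> : 2 * s * eps * beta = 2 * A by rewrite /A; ring.
lra.
Qed.

Lemma saturated_path s :
  path.path adj y s -> last y s = x -> z \notin y :: s -> saturated x.
Proof.
have : saturated y by move=> eps eps0; exists 1 => // g _ _ _ -> _; lra.
elim: s {1 2 3 4}y => [u sat _ <- //|v s IH u sat] /= /andP[uv vs] lastx.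
rewrite inE negb_or => /andP[zu zvs].
(* Propagation stops at the first visit to [x], where the value is prescribed and cannot be
   lowered. *)
have [<-//|ux] := eqVneq u x.
by apply: (IH v) => //; apply: saturated_adj uv sat => //; rewrite eq_sym.
Qed.

(** Saturation at [x] contradicts [g x = 0]. Hence functions that equal their maximum 1 at both [y]
    and [z] and vanish at [x] have energy above [r^-1 + delta], whose inverse serves as [rho]. *)
Lemma resistance_gap s :
  path.path adj y s -> last y s = x -> z \notin y :: s ->
  exists2 rho : R, 0 <= rho < r &
    forall g (e : R), (forall u, g u <= g z) -> g y = g z ->
      (energy b g <= e%:E)%E -> (g z - g x) ^+ 2 <= rho * e.
Proof.
move=> ys lastx zs; have r0 := resistance_gt0 xz xzr.
have half0 : (0 : R) < 2^-1 by rewrite invr_gt0.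
have [delta delta0 Hdelta] := saturated_path ys lastx zs half0.
have q0 : 0 < r^-1 + delta by rewrite addr_gt0 ?invr_gt0.
exists (r^-1 + delta)^-1.
  rewrite invr_ge0 (ltW q0)/= -[X in _ < X]invrK ltf_pV2 ?posrE ?invr_gt0//.
  by rewrite ltrDl.
move=> g e gmax gy ge; rewrite leNgt; apply/negP => lt_e.
have e0 : 0 <= e by rewrite -lee_fin; apply: le_trans ge; exact: energy_ge0.
set p := g z - g x in lt_e.
have p0 : 0 < p.
  rewrite lt_neqAle subr_ge0 gmax andbT eq_sym; apply/eqP => p0.
  by move: lt_e; rewrite p0 expr0n ltNge mulr_ge0// invr_ge0 ltW.
(* Affine normalisation to the values 0 at [x] and 1 at [z]. *)
pose h u := p^-1 * (g u - g x).
have hE : (energy b h <= (r^-1 + delta)%:E)%E.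
  rewrite energyZ ?invr_eq0 ?gt_eqF//.
  rewrite (@eq_energy _ _ _ _ g); last by move=> u v; congr (_ ^+ 2); ring.
  apply: (@le_trans _ _ ((p^-1 ^+ 2)%:E * e%:E)%E).
    by rewrite lee_wpmul2l// lee_fin sqr_ge0.
  rewrite -EFinM lee_fin exprVn ler_pdivrMl ?exprn_gt0// mulrC.
  by rewrite -ler_pdivrMl// ltW.
have hx0 : h x = 0 by rewrite /h subrr mulr0.
have h1 : h z = 1 by rewrite /h mulVf ?gt_eqF.
have := Hdelta h _ hx0 h1 _ hE; rewrite hx0 => H.
suff : 1 - 2^-1 <= 0 :> R by lra.
apply: H => [v|]; last by rewrite -h1 /h gy.
by rewrite -h1 ler_pM2l ?invr_gt0// lerD2r.
Qed.

End StrictTriangle.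

(** Cutting at the level of [z] with the improved constant [rho < r1]; the other two bounds, [r1]
    and [r2], lie below the sum because both are positive. *)
Lemma resistance_triangle_lt x y z (r1 r2 : R) s :
  x != z -> z != y ->
  (resistance b x z <= r1%:E)%E -> (resistance b z y <= r2%:E)%E ->
  path.path adj y s -> last y s = x -> z \notin y :: s ->
  (resistance b x y < (r1 + r2)%:E)%E.
Proof.
move=> xz zy xzr zyr ys lastx zs.
have r1_gt0 := resistance_gt0 xz xzr; have r2_gt0 := resistance_gt0 zy zyr.
have [rho /andP[rho0 rho_lt] Hrho] := resistance_gap xz xzr ys lastx zs.
apply: (le_lt_trans (resistance_cut_level xzr zyr rho0 Hrho)).
by rewrite lte_fin !gt_max; apply/and3P; split; lra.
Qed.

Lemma resistance_separated x y z (r r1 r2 : R) :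
  (forall s, path.path adj x s -> last x s = y -> z \in x :: s) ->
  resistance b x y = r%:E -> resistance b x z = r1%:E ->
  resistance b z y = r2%:E -> r1 + r2 <= r.
Proof.
move=> sep xyr xzr zyr.
(* Weighting [f] and [g] by their own drops [A] and [B] gives a glued function with drop
   [A ^+ 2 + B ^+ 2] and at most that energy, so one factor cancels. *)
have key f g : (energy b f <= 1%:E)%E -> (energy b g <= 1%:E)%E ->
    (f z - f x) ^+ 2 + (g y - g z) ^+ 2 <= r.
  move=> f1 g1; set A := f z - f x; set B := g y - g z.
  (* The vertices reachable from [x] without meeting [z]. An edge leaves [C] only towards [z], where
     both halves of [h] vanish. *)
  pose C u := `[< exists s, [/\ path.path adj x s, last x s = u & z \notin x :: s] >].
  pose h u := if C u then A * (f u - f z) else B * (g u - g z).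
  have Cz : ~~ C z.
    by apply/asboolPn => -[s [_ <-]]; rewrite mem_last.
  have Cy : ~~ C y.
    by apply/asboolPn => -[s [xs lasty]]; rewrite sep.
  have Cadj u v : C u -> ~~ C v -> 0 < b u v -> v = z.
    move=> /asboolP[s [xs lastu zs]] /asboolPn nCv uv.
    apply/eqP; apply: contra_notT nCv => vz; exists (rcons s v).
    rewrite last_rcons -cats1 cat_path xs /= lastu /adj uv; split => //.
    by rewrite -cat_cons mem_cat negb_or zs inE eq_sym.
  have hE : (energy b h <= (A ^+ 2 * 1 + B ^+ 2 * 1)%:E)%E.
    apply: energy_glue (energyZ_le gb A f1) (energyZ_le gb B g1) => // u v.
    have [buv|] := ltP 0 (b u v); last first.
      by move=> le0; have -> : b u v = 0 by [apply/eqP; rewrite eq_le le0 b_ge0];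
        rewrite !mul0r addr0.
    rewrite -mulrDr ler_pM2l// -!mulrBr /h.
    case: ifPn => Cu; case: ifPn => Cv.
    - rewrite -mulrBr opprB addrA subrK -[X in X <= _]addr0 lerD2l; exact: sqr_ge0.
    - rewrite (Cadj _ _ Cu Cv buv) subrr mulr0 subr0 -[X in X <= _]addr0 lerD2l.
      exact: sqr_ge0.
    - have buv' : 0 < b v u by rewrite bC.
      rewrite (Cadj _ _ Cv Cu buv') subrr mulr0 sub0r sqrrN.
      by have := sqr_ge0 (B * (g z - g v)); nra.
    - rewrite -mulrBr opprB addrA subrK -[X in X <= _]add0r lerD2r; exact: sqr_ge0.
  have := sqr_le_resistance (_ : resistance b x y <= r%:E)%E hE.
  rewrite xyr => /(_ (lexx _)).
  have -> : h y - h x = A ^+ 2 + B ^+ 2.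
    rewrite /h (negbTE Cy); case: ifPn => [_|/asboolPn nCx].
      by rewrite /A /B; ring.
    have zx : z = x.
      by apply/eqP; apply: contra_notT nCx => zx; exists [::]; rewrite /= inE.
    by rewrite /A -zx !subrr /B; ring.
  rewrite !mulr1 => le1; rewrite leNgt; apply/negP => lt_r.
  have r0 : 0 <= r by rewrite -lee_fin -xyr; exact: resistance_ge0.
  have T0 : 0 < A ^+ 2 + B ^+ 2 by exact: le_lt_trans lt_r.
  by move: le1; rewrite expr2 ler_pM2r// leNgt lt_r.
have c0 : (energy b (fun=> 0%R) <= 1%:E)%E by rewrite energy_const lee_fin.
have key0 g : (energy b g <= 1%:E)%E -> (g y - g z) ^+ 2 <= r.
  by move=> g1; have := key _ g c0 g1; rewrite subrr expr0n add0r.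
(* The suprema are taken one after the other: over [f] for fixed [g] here, then over [g]. *)
have key1 g : (energy b g <= 1%:E)%E -> r1 <= r - (g y - g z) ^+ 2.
  move=> g1; rewrite -lee_fin -xzr; apply: resistance_le.
    by rewrite subr_ge0 key0.
  by move=> f f1; have := key f g f1 g1; lra.
have r1r : r1 <= r by have := key1 _ c0; rewrite subrr expr0n subr0.
suff : r2 <= r - r1 by lra.
rewrite -lee_fin -zyr; apply: resistance_le; first by rewrite subr_ge0.
by move=> g /key1; lra.
Qed.

End Resistance.

(** * Induced paths *)

Section InducedPaths.
Context {R : realType} {X : countType} (b : X -> X -> R).
Hypothesis gb : is_graph b.

Let bC x y : b x y = b y x. Proof. by case: gb => _ []. Qed.
Let bxx x : b x x = 0. Proof. by case: gb => _ [] _ []. Qed.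

Lemma induced_path_nil x : induced_path b x x [::].
Proof.
split=> //; split=> // -[|i] [|j] //= _ _; rewrite bxx ltxx.
by split=> // -[].
Qed.

(** Turns the definition by indices into a recursion on the first vertex, on which the inductions
    below rest. *)
Lemma induced_path_cons x y a s : induced_path b x y (a :: s) <->
  [/\ x \notin a :: s, adj b x a, {in s, forall v, ~~ adj b x v} &
      induced_path b a y s].
Proof.
split=> [[/= /andP[xs us] [lasty I]]|[xs xa nadj [us [lasty I]]]].
  split=> //; first by apply/(I 0 1)%N => //; right.
    move=> v vs; apply/negP => xv.
    have := I 0%N (index v s).+2; rewrite !ltnS index_mem => /(_ isT vs) /=.
    by rewrite nth_index// => -[/(_ xv)[]].
  split=> //; split=> // i j i_lt j_lt.
  have := I i.+1 j.+1; rewrite !ltnS => /(_ i_lt j_lt).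
  rewrite -[nth x _ i.+1]/(nth x (a :: s) i) -[nth x _ j.+1]/(nth x (a :: s) j).
  rewrite !(set_nth_default a x)// => ->.
  by clear; lia.
split; first by rewrite cons_uniq xs.
split=> // i j i_lt j_lt.
wlog ij : i j i_lt j_lt / (i <= j)%N.
  move=> H; have [/H|/ltnW/H] := leqP i j; first exact.
  by rewrite bC => -> //; split=> -[] e; [right|left|right|left].
case: i j i_lt j_lt ij => [|i] [|[|j]] // i_lt j_lt ij.
- by rewrite /= bxx ltxx; split=> // -[].
- by split=> // _; right.
- split=> [xv|[]//]; have /nadj : nth x s j \in s by rewrite mem_nth.
  by rewrite /adj xv.
- case: i i_lt ij => //= _ _; rewrite bxx ltxx; split=> // -[] //.
- have := I i j.+1 i_lt j_lt.
  rewrite -[nth x _ i.+1]/(nth x (a :: s) i) -[nth x _ j.+2]/(nth x (a :: s) j.+1).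
  rewrite !(set_nth_default a x)// => ->.
  by clear; lia.
Qed.

Lemma induced_path_path x y s : induced_path b x y s -> path.path (adj b) x s.
Proof.
elim: s x => [//|a s IH] x /induced_path_cons[_ xa _ /IH] /=.
by rewrite xa.
Qed.

(** Take the shortcut to the last vertex of the path that equals [x] or is adjacent to it; from
    there on the path meets [x] no more. *)
Lemma induced_path_extend x c y t :
  induced_path b c y t -> (x \in c :: t) || has (adj b x) (c :: t) ->
  exists2 t', induced_path b x y t' & {subset x :: t' <= x :: c :: t}.
Proof.
elim: t c => [|d t IH] c ct.
  have -> : y = c by case: ct => _ [].
  have [-> _|xc /=] := eqVneq x c.
    exists [::]; first exact: induced_path_nil.
    by move=> v vc; rewrite in_cons vc orbT.
  rewrite inE (negbTE xc) orbF /= => xc'; exists [:: c] => //.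
  apply/induced_path_cons; split => //; last exact: induced_path_nil.
  by rewrite inE.
have [dt|ndt] := boolP ((x \in d :: t) || has (adj b x) (d :: t)).
  have [_ _ _ dpath] := (induced_path_cons c y d t).1 ct.
  have [t' xt' sub] := IH d dpath dt; exists t' => // v /sub.
  by rewrite !inE => /or3P[] ->; rewrite ?orbT.
have [-> _|xc] := eqVneq x c.
  by exists (d :: t) => // v vdt; rewrite in_cons vdt orbT.
move: ndt; rewrite negb_or => /andP[xdt nadj].
have consE : has (adj b x) (c :: d :: t) = adj b x c || has (adj b x) (d :: t) by [].
rewrite in_cons (negbTE xc) (negbTE xdt) consE (negbTE nadj) !orbF => xc'.
exists (c :: d :: t) => //; apply/induced_path_cons; split => //.
  by rewrite in_cons negb_or xc.
by move=> v vdt; exact: (hasPn nadj).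
Qed.

Lemma induced_path_exists x s : path.path (adj b) x s ->
  exists2 t, induced_path b x (last x s) t & {subset x :: t <= x :: s}.
Proof.
elim: s x => [|a s IH] x /=.
  by exists [::] => //; exact: induced_path_nil.
move=> /andP[xa /IH[t at_ sub]].
have [|t' xt' sub'] := @induced_path_extend x _ _ _ at_; first by rewrite /= xa orbT.
exists t' => // v /sub'; rewrite !(in_cons x) => /orP[->//|/sub ->].
by rewrite orbT.
Qed.

(** Two induced paths with the same ends share their second vertex: it is [y] if [x] and [y] are
    adjacent, and the separating neighbour otherwise. Induction then treats the tails. *)
Lemma separated_block_graph : connected_graph b ->
  (forall x y, x != y -> ~~ adj b x y -> exists2 z, adj b x z &
     forall s, path.path (adj b) x s -> last x s = y -> z \in x :: s) ->
  block_graph b.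
Proof.
move=> cb sep x y.
have [s0 [xs0 <-]] := cb x y.
have [s xs _] := induced_path_exists xs0; exists s; split => // t.
move: (last x s0) xs => {xs0 y s0}; elim: s x t => [|a s IH] x [|c t] y //.
(* An empty path forces equal ends, and a nonempty one would then repeat a vertex. *)
- move=> [_ [lastx _]] [/andP[+ _] [lastct _]].
  by move: lastx lastct => /= -> <-; rewrite mem_last.
- move=> [/andP[+ _] [lastas _]] [_ [lastx _]].
  by move: lastx lastas => /= -> <-; rewrite mem_last.
move=> xs xt.
have second d u : induced_path b x y (d :: u) -> x != y /\ 
    (forall v, v \in x :: d :: u -> adj b x v -> v = d).
  move=> /induced_path_cons[xdu _ nadj [_ [lasty _]]]; split.
    by apply: contraNneq xdu => ->; rewrite -lasty mem_last.
  move=> v; rewrite !in_cons => /or3P[/eqP->|/eqP//|/nadj/negbTE->//].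
  by rewrite /adj bxx ltxx.
suff ac : a = c.
  move: xs xt => /induced_path_cons[_ _ _ as_] /induced_path_cons[_ _ _ ct].
  by rewrite ac (IH c t y) // -ac.
have [xy sa] := second _ _ xs; have [_ sc] := second _ _ xt.
have [xyadj|nxy] := boolP (adj b x y).
  transitivity y; [symmetry; apply: sa => //|apply: sc => //].
    by case: xs => _ [<- _]; rewrite mem_last.
  by case: xt => _ [<- _]; rewrite mem_last.
have [z xz zsep] := sep x y xy nxy.
transitivity z; [symmetry; apply: sa => //|apply: sc => //]; apply: zsep.
- exact: induced_path_path xs.
- by case: xs => _ [].
- exact: induced_path_path xt.
- by case: xt => _ [].
Qed.

End InducedPaths.

(** * Resistance as a path metric *)

Section Main.
Context {R : realType} {X : countType} (b : X -> X -> R).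
Hypotheses (gb : is_graph b) (lf : locally_finite b) (cb : connected_graph b).

(** Every path from [x] to [y] contains the vertices of an induced one, which by uniqueness is the
    given path through [a]. *)
Lemma block_graph_separated x y a s : block_graph b ->
  induced_path b x y (a :: s) ->
  forall t, path.path (adj b) x t -> last x t = y -> a \in x :: t.
Proof.
move=> bb xas t xt lasty; apply: contraT => at_.
have [t' xt' sub] := induced_path_exists gb xt; rewrite lasty in xt'.
have [t0 [_ uniq_t0]] := bb x y.
have t'as : t' = a :: s by rewrite -(uniq_t0 _ xt') (uniq_t0 _ xas).
by move: at_; rewrite sub// t'as !in_cons eqxx orbT.
Qed.

Definition edge_resistance (x y : X) : \bar R :=
  if x == y then 0%E else if adj b x y then resistance b x y else +oo%E.

Lemma resistance_le_edge_resistance x y :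
  (resistance b x y <= edge_resistance x y)%E.
Proof.
rewrite /edge_resistance; have [->|_] := eqVneq x y; first by rewrite resistancexx.
by case: ifP => // _; exact: leey.
Qed.

Lemma edge_resistance_weight : is_weight edge_resistance.
Proof.
split=> [x y|].
  by apply: le_trans (resistance_le_edge_resistance x y); exact: resistance_ge0.
split=> x y.
  rewrite /edge_resistance eq_sym resistanceC /adj.
  by case: gb => _ [-> _].
rewrite /edge_resistance; split=> [|->]; last by rewrite eqxx.
have [//|xy] := eqVneq x y; case: ifP => // _ E0.
have := resistance_gt0 gb lf cb xy (_ : resistance b x y <= 0%:E)%E.
by rewrite E0 ltxx => /(_ (lexx _)).
Qed.

Lemma block_graph_resistance : block_graph b ->
  forall x y, resistance b x y = delta edge_resistance x y.
Proof.
move=> bb x y; apply/eqP; rewrite eq_le; apply/andP; split.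
  apply: le_ereal_inf_tmp => _ [s [_ <-] <-].
  elim: s x => [|a s IH] x; first by rewrite big_nil resistancexx.
  rewrite big_cons; apply: le_trans (leeD (resistance_le_edge_resistance x a) (IH a)).
  exact: resistance_triangle.
(* For the other inequality, the induced path itself is the competitor. *)
have [s [xs _]] := bb x y.
suff cost : (\sum_(p <- zip (x :: s) s) edge_resistance p.1 p.2 <=
             resistance b x y)%E.
  apply: le_trans cost; apply: ereal_inf_lbound; exists s => //.
  by case: xs => us [].
elim: s x xs => [|a s IH] x xs.
  by rewrite big_nil; exact: resistance_ge0.
have sep := block_graph_separated bb xs.
have [xas xa _ as_] := (induced_path_cons gb x y a s).1 xs.
rewrite big_cons; apply: (le_trans (leeD2l _ (IH a as_))).
rewrite /edge_resistance /= (negbTE (adj_neq gb xa)) xa.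
have [r xyr] := resistance_fin gb cb x y.
have [r1 xar] := resistance_fin gb cb x a.
have [r2 ayr] := resistance_fin gb cb a y.
rewrite xyr xar ayr -EFinD lee_fin.
exact: (resistance_separated gb _ sep xyr xar ayr).
Qed.

(** A competitor whose first step is not an edge costs [+oo]; otherwise its first step and its
    remainder are competitors for the two distances through [a]. *)
Lemma delta_first_step (w : X -> X -> \bar R) x y (m : \bar R) :
  is_weight w -> compatible b w -> x != y -> ~~ adj b x y ->
  (forall a, adj b x a -> (m <= delta w x a + delta w a y)%E) ->
  (m <= delta w x y)%E.
Proof.
move=> [w0 _] wb xy nxy Hm; apply: le_ereal_inf_tmp => _ [[|a s] [us lasty] <-].
  by move: xy; rewrite -lasty eqxx.
move: us; rewrite [uniq _]/= => /andP[xas us].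
have s0 : (0 <= \sum_(p <- zip (a :: s) s) w p.1 p.2)%E by exact: sume_ge0.
rewrite big_cons /=.
have [xa|nxa] := boolP (adj b x a).
  apply: (le_trans (Hm a xa)); apply: leeD; apply: ereal_inf_lbound.
    exists [:: a]; last by rewrite /= big_seq1.
    by split=> //=; rewrite inE andbT (adj_neq gb xa).
  by exists s.
have -> : w x a = +oo%E.
  apply: wb; first by move=> xa; rewrite xa mem_head in xas.
  by apply/eqP; rewrite eq_le leNgt nxa; case: gb => ->.
by rewrite addye ?leey// gt_eqF// (lt_le_trans _ s0)// ltNyr.
Qed.

Lemma weight_separated (w : X -> X -> \bar R) x y :
  is_weight w -> compatible b w ->
  (forall x y, resistance b x y = delta w x y) ->
  x != y -> ~~ adj b x y ->
  exists2 z, adj b x z &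
    forall s, path.path (adj b) x s -> last x s = y -> z \in x :: s.
Proof.
move=> ww wb Rw xy nxy; apply: contrapT => nz.
have lt a : adj b x a ->
    (resistance b x y < resistance b x a + resistance b a y)%E.
  move=> xa; have /existsNP[s /not_implyP[xs /not_implyP[lasty /negP as_]]] :
      ~ forall s, path.path (adj b) x s -> last x s = y -> a \in x :: s.
    by move=> sep; apply: nz; exists a.
  have [r1 xar] := resistance_fin gb cb x a.
  have [r2 ayr] := resistance_fin gb cb a y.
  (* The ends are swapped because the strict inequality expects a path from its second end to its
     first. *)
  rewrite xar ayr addeC -EFinD resistanceC.
  apply: (resistance_triangle_lt gb lf cb _ _ _ _ xs lasty as_).
  - by apply: contraNneq nxy => ->.
  - by rewrite eq_sym (adj_neq gb xa).
  - by rewrite resistanceC ayr.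
  - by rewrite resistanceC xar.
have /finite_seqP[N NE] := lf x.
(* A minimum over the finitely many neighbours keeps the inequality strict; [+oo] serves for the
   empty list. *)
have [m m_gt Hm] : exists2 m : \bar R, (resistance b x y < m)%E &
    forall a, a \in N -> (m <= resistance b x a + resistance b a y)%E.
  have : {in N, forall a, adj b x a}.
    by move=> a aN; have : [set` N] a by []; rewrite -NE.
  elim: N {NE} => [_|a N IH aN].
    by have [r ->] := resistance_fin gb cb x y; exists +oo%E => //; exact: ltry.
  have [a' a'N|m m_gt Hm] := IH; first by apply: aN; rewrite in_cons a'N orbT.
  exists (Order.min (resistance b x a + resistance b a y : \bar R)%E m).
    by rewrite lt_min m_gt lt// aN ?mem_head.
  move=> c; rewrite in_cons => /orP[/eqP->|/Hm mc]; rewrite ge_min ?lexx//.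
  by rewrite mc orbT.
have : (m <= resistance b x y)%E.
  rewrite Rw; apply: delta_first_step ww wb xy nxy _ => a xa.
  rewrite -!Rw; apply: Hm.
  have : [set` N] a by rewrite -NE.
  by [].
by rewrite leNgt m_gt.
Qed.

End Main.

Theorem theorem3p4 (R : realType) (X : countType) (b : X -> X -> R) :
  is_graph b -> locally_finite b -> connected_graph b ->
  ((exists w : X -> X -> \bar R,
      is_weight w /\ compatible b w /\
      (forall x y, resistance b x y = delta w x y))
   <-> block_graph b).
Proof.
move=> gb lf cb; split=> [[w [ww [wb Rw]]]|bb].
  apply: separated_block_graph => // x y; exact: weight_separated Rw.
exists (edge_resistance b); split; first exact: edge_resistance_weight.
split; last exact: block_graph_resistance.
move=> x y /eqP xy bxy.
by rewrite /edge_resistance (negbTE xy) /adj bxy ltxx.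
Qed.
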